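(* Let $q$ be a prime power, $m,n$ positive integers and $k\ge2$ an integer. Let $\mathcal{U}$ be an $[n,k]_{q^m/q}$ system which is a linear cutting blocking set. Then $\mathcal{U}$, regarded as an $\mathbb{F}_q$-subspace of $\mathbb{F}_{q^{m(k-1)}}^k$ via $\mathbb{F}_{q^m}\subseteq\mathbb{F}_{q^{m(k-1)}}$, is a rank-$(k-1)$-saturating $[n,k]_{q^{m(k-1)}/q}$ system.
   Context: For an extension $\mathbb{F}_{Q}$ of $\mathbb{F}_q$, an $[n,k]_{Q/q}$ system is an $n$-dimensional $\mathbb{F}_q$-subspace $\mathcal{U}\le\mathbb{F}_{Q}^k$ with $\langle\mathcal{U}\rangle_{\mathbb{F}_{Q}}=\mathbb{F}_{Q}^k$; its linear set is $L_\mathcal{U}=\{\langle u\rangle_{\mathbb{F}_Q}:u\in\mathcal{U}\setminus\{0\}\}\subseteq\mathrm{PG}(k-1,Q)$. A point set of $\mathrm{PG}(k-1,Q)$ is $r$-saturating if every point lies in the span of some $r+1$ of its points and $r$ is minimal with this property; $\mathcal{U}$ is rank-$\rho$-saturating if $L_\mathcal{U}$ is $(\rho-1)$-saturating. An $[n,k]_{q^m/q}$ system $\mathcal{U}$ is a linear cutting blocking set if for every $\mathbb{F}_{q^m}$-hyperplane $\mathcal{H}$ of $\mathbb{F}_{q^m}^k$ one has $\langle\mathcal{H}\cap\mathcal{U}\rangle_{\mathbb{F}_{q^m}}=\mathcal{H}$. *)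

(* Defs.v *)
From HB Require Import structures.
From mathcomp Require Import all_boot all_order all_algebra all_field.

Set Implicit Arguments.
Unset Strict Implicit.
Unset Printing Implicit Defensive.

Import GRing.Theory.
Local Open Scope ring_scope.

(* K^k is used through two library structures: F-subspaces of K^k are
   {vspace {ffun 'I_k -> K}} (F acts coordinatewise), while K-subspaces of K^k
   are {vspace 'rV[K]_k}; torow is the identity of K^k between the two. *)
Definition torow (K : nzRingType) (k : nat) (u : {ffun 'I_k -> K}) : 'rV[K]_k :=
  \row_i u i.

Definition is_span (K : fieldType) (V : vectType K) (A : V -> Prop)
    (W : {vspace V}) : Prop :=
  (forall v, A v -> v \in W) /\
  (forall W' : {vspace V}, (forall v, A v -> v \in W') -> (W <= W')%VS).

Section Systems.
Variables (F : fieldType) (K : fieldExtType F) (k : nat).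
Implicit Types (U : {vspace {ffun 'I_k -> K}}).

Definition vec_of U (v : 'rV[K]_k) : Prop := exists2 u, u \in U & v = torow u.

(* [n, k]_{Q/q} system, where F = F_q and K = F_Q. *)
Definition is_system (n : nat) U : Prop :=
  \dim U = n /\ is_span (vec_of U) fullv.

Definition linear_cutting_blocking_set U : Prop :=
  forall H : {vspace 'rV[K]_k}, \dim H = k.-1 ->
    is_span (fun v => v \in H /\ vec_of U v) H.

(* Points of PG(k-1, Q) are the one-dimensional K-subspaces of K^k. *)
Definition linear_set U (P : {vspace 'rV[K]_k}) : Prop :=
  exists u, [/\ u \in U, u != 0 & P = <[torow u]>%VS].

End Systems.

Section Saturating.
Variables (K : fieldType) (k : nat).
Implicit Types (S : {vspace 'rV[K]_k} -> Prop).

Definition points_covered (r : nat) S : Prop :=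
  forall P : {vspace 'rV[K]_k}, \dim P = 1%N ->
    exists s : r.+1.-tuple {vspace 'rV[K]_k},
      [/\ uniq s, (forall Q, Q \in s -> S Q) & (P <= \sum_(Q <- s) Q)%VS].

Definition saturating (r : nat) S : Prop :=
  points_covered r S /\ (forall r' : nat, points_covered r' S -> (r <= r')%N).

End Saturating.

Definition rank_saturating (F : fieldType) (K : fieldExtType F) (k rho : nat)
    (U : {vspace {ffun 'I_k -> K}}) : Prop :=
  (0 < rho)%N /\ saturating rho.-1 (linear_set U).

Section ExtendField.
Variables (F : fieldType) (L E : fieldExtType F) (iota : {lrmorphism L -> E}).
Variable k : nat.

Definition ffun_embed (u : {ffun 'I_k -> L}) : {ffun 'I_k -> E} :=
  [ffun i => iota (u i)].

Fact ffun_embed_is_linear : linear ffun_embed.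
Proof. by move=> a u v; apply/ffunP => i; rewrite !ffunE linearP. Qed.

HB.instance Definition _ :=
  GRing.isLinear.Build F {ffun 'I_k -> L} {ffun 'I_k -> E} *:%R ffun_embed
    ffun_embed_is_linear.

Definition extend_field (U : {vspace {ffun 'I_k -> L}}) :
  {vspace {ffun 'I_k -> E}} := (linfun ffun_embed @: U)%VS.

Lemma mem_extend_fieldP (U : {vspace {ffun 'I_k -> L}}) v :
  reflect (exists2 u, u \in U & v = ffun_embed u) (v \in extend_field U).
Proof.
apply: (iffP memv_imgP) => -[u uU ->]; exists u => //; by rewrite lfunE.
Qed.

End ExtendField.

(* Main.v *)
(** Let [d = k - 1 = [E : L]] and let [b] be an [L]-basis of [E].  A vector [v]
    of [E^k] is [b *m C] for a unique [d x k] matrix [C] over [L].  The rows of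
    [C] lie in a hyperplane of [L^k]; as [U] is cutting, that hyperplane has a
    basis of [d] vectors of [U], and [v] lies in their [E]-span.  Conversely, if
    [C] has rank [d], any family of vectors of [L^k] whose [E]-span contains [v]
    has all rows of [C] in its [L]-span, hence at least [d] members. *)

Require Import Defs.
From Stdlib Require Import Classical.
From mathcomp Require Import all_boot all_order all_algebra all_field.

Set Implicit Arguments.
Unset Strict Implicit.
Unset Printing Implicit Defensive.

Import GRing.Theory.
Local Open Scope ring_scope.

Lemma exists_superspace (K : fieldType) (V : vectType K) (W : {vspace V}) j :
  (\dim W <= j <= \dim {:V})%N -> exists2 H : {vspace V}, (W <= H)%VS & \dim H = j.
Proof.
elim: j => [|j IHj] /andP[leWj lejV].
  by exists W => //; apply/eqP; rewrite -leqn0.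
move: leWj; rewrite leq_eqVlt => /predU1P[|leWj]; first by exists W.
have [|H sWH dimH] := IHj; first by rewrite -ltnS leWj ltnW.
have /subvPn[v _ H'v] : ~~ ({:V} <= H)%VS.
  by apply: contraL lejV => /dimvS; rewrite dimH -leqNgt.
have fvH : free (v :: vbasis H).
  by rewrite free_cons (span_basis (vbasisP H)) H'v (basis_free (vbasisP H)).
exists <<v :: vbasis H>>%VS; last by rewrite (eqnP fvH) /= size_tuple dimH.
by rewrite span_cons (span_basis (vbasisP H)) (subv_trans sWH) ?addvSr.
Qed.

(** The independent family is built greedily. [A] is an arbitrary predicate, so the next vector is
    obtained by classical logic. *)
Lemma is_span_free (K : fieldType) (V : vectType K) (A : V -> Prop) W j :
  is_span A W -> (j <= \dim W)%N ->
  exists X : seq V, [/\ size X = j, free X & forall v, v \in X -> A v].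
Proof.
move=> spanA; elim: j => [|j IHj] ltjW; first by exists [::]; rewrite nil_free.
have [X [szX frX AX]] := IHj (ltnW ltjW).
have [v nAX] : exists v, ~ (A v -> v \in <<X>>%VS).
  (* If [<<X>>] contained all of [A], minimality of [W] would give [W <= <<X>>], although [<<X>>]
     has dimension [j < \dim W]. *)
  apply: not_all_ex_not => sAX; have /dimvS := spanA.2 _ sAX.
  by rewrite (eqnP frX) szX leqNgt ltjW.
have [Av X'v] := imply_to_and _ _ nAX.
exists (v :: X); split; first by rewrite /= szX.
- by rewrite free_cons frX andbT; apply/negP.
- by move=> w; rewrite inE => /predU1P[->|/AX].
Qed.

(** Puts a basis of [W] taken from [A] into matrix form, so that it can be carried to an extension
    field by [map_mx]. *)
Lemma is_span_row_free (K : fieldType) (k : nat) (A : 'rV[K]_k -> Prop) W d :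
  is_span A W -> \dim W = d ->
  exists M : 'M[K]_(d, k), [/\ row_free M, forall i, A (row i M)
    & forall v, v \in W -> (v <= M)%MS].
Proof.
move=> spanA dimW; have [X [szX frX AX]] := is_span_free spanA (leqnn _).
have {szX}szX : size X == d by rewrite szX dimW.
pose M : 'M_(d, k) := \matrix_i (Tuple szX)`_i.
have mulM (a : 'rV_d) : a *m M = \sum_i a 0 i *: (Tuple szX)`_i.
  by rewrite mulmx_sum_row; apply: eq_bigr => i _; rewrite rowK.
have basisX : basis_of W (Tuple szX).
  rewrite basisEfree frX dimW size_tuple leqnn andbT /=.
  by apply/span_subvP => v /AX /spanA.1.
exists M; split.
- apply: inj_row_free => a; rewrite mulM => a0; apply/rowP => i; rewrite mxE.
  by move/freeP: (frX : free (Tuple szX)); apply.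
- by move=> i; rewrite rowK; apply: AX; rewrite mem_nth // (eqP szX).
- move=> v Wv; apply/submxP; exists (\row_i coord (Tuple szX) i v).
  rewrite mulM [LHS](coord_basis basisX Wv).
  by apply: eq_bigr => i _; rewrite mxE.
Qed.

Lemma mulmx_memv (K : fieldType) (d k : nat) (W : {vspace 'rV[K]_k})
    (a : 'rV[K]_d) (M : 'M[K]_(d, k)) :
  (forall i, row i M \in W) -> a *m M \in W.
Proof.
by move=> MW; rewrite mulmx_sum_row; apply: memv_suml => i _; apply: memvZ.
Qed.

(** Provides the distinctness of points required by [points_covered]. If row [i] is [c] times row
    [j], cancelling [M] leaves the same relation between unit vectors, which fails at entry [i]
    unless [i = j]. *)
Lemma row_free_line_inj (K : fieldType) (d k : nat) (M : 'M[K]_(d, k)) :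
  row_free M -> injective (fun i => <[row i M]>%VS).
Proof.
move=> frM i j /= eq_ij.
have /vlineP[c] : row i M \in <[row j M]>%VS by rewrite -eq_ij memv_line.
rewrite !rowE scalemxAl => /(row_free_inj frM) /rowP /(_ i) /eqP.
rewrite !mxE !eqxx /=; case: (i =P j) => // _ /=.
by rewrite mulr0 oner_eq0.
Qed.

Section Extension.
Variables (F : fieldType) (L E : fieldExtType F) (iota : {lrmorphism L -> E}).

Lemma fieldExt_row_basis (d : nat) : \dim {:E} = (\dim {:L} * d)%N ->
  exists b : 'rV[E]_d,
    (forall k (v : 'rV[E]_k), exists C : 'M[L]_(d, k), v = b *m map_mx iota C)
    /\ (forall k (C : 'M[L]_(d, k)), b *m map_mx iota C = 0 -> C = 0).
Proof.
(* [E] is only given as an extension of [F], so [L] is replaced by its image [K], a subfield of [E]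
   of the same [F]-dimension. *)
move=> dimE; pose K := (linfun iota @: {:L})%AS.
have memK x : reflect (exists a, x = iota a) (x \in K).
  apply: (iffP memv_imgP) => [[a _ ->]|[a ->]]; exists a; by rewrite ?lfunE ?memvf.
have dimK : \dim K = \dim {:L}.
  apply: limg_dim_eq; apply/eqP; rewrite -subv0; apply/subvP => a.
  by rewrite memv_cap memv_ker lfunE fmorph_eq0 memv0 => /andP[].
(* As a [K]-module, [E] is the direct sum of [\dim {:E} / \dim K = d] lines [K * <[X_i]>]; the [X_i]
   are the entries of [b]. *)
have := field_module_semisimple (subvf (K * {:E})%VS).
rewrite /= dimK dimE mulKn ?adim_gt0 // => -[X [_ nzX] [sumX dxX]].
exists (\row_i X`_i); split=> k.
  move=> v.
  have [C vC] : exists C : 'M[L]_(d, k), forall j, v 0 j = \sum_i iota (C i j) * X`_i.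
    have colP j : exists c : {ffun 'I_d -> L}, v 0 j == \sum_i iota (c i) * X`_i.
      have /memv_sumP[y Ky ->] : v 0 j \in (\sum_(i < d) K * <[X`_i]>)%VS.
        by rewrite sumX memvf.
      have cP i : exists a, y i == iota a * X`_i.
        by have /memv_cosetP[_ /memK[a ->] ->] := Ky i isT; exists a.
      exists [ffun i => xchoose (cP i)]; apply/eqP/eq_bigr => i _.
      by rewrite ffunE; apply/eqP/(xchooseP (cP i)).
    exists (\matrix_(i, j) xchoose (colP j) i) => j.
    by rewrite [LHS](eqP (xchooseP (colP j))); apply: eq_bigr => i _; rewrite mxE.
  exists C; apply/rowP => j; rewrite vC mxE.
  by apply: eq_bigr => i _; rewrite !mxE mulrC.
move=> C bC0; apply/matrixP => i j; rewrite mxE; apply/eqP.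
have /eqP : iota (C i j) * X`_i = 0.
  move/directv_sum_independent: dxX.
  move=> /(_ (fun i => iota (C i j) * X`_i)); apply=> // [i' _|].
    by rewrite memv_mul ?memv_line //; apply/memK; exists (C i' j).
  move/rowP/(_ j): bC0; rewrite !mxE ; apply: etrans.
  by apply: eq_bigr => i' _; rewrite !mxE mulrC.
rewrite mulf_eq0 fmorph_eq0 => /orP[] // /idPn[].
by rewrite (memPn nzX) // mem_nth // size_tuple.
Qed.

Variable k : nat.
Implicit Type U : {vspace {ffun 'I_k -> L}}.

Lemma torow_embed (u : {ffun 'I_k -> L}) :
  torow (ffun_embed iota u) = map_mx iota (torow u).
Proof. by apply/rowP => i; rewrite !mxE ffunE. Qed.

Lemma dim_extend_field U : \dim (extend_field iota U) = \dim U.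
Proof.
apply: limg_dim_eq; apply/eqP; rewrite -subv0; apply/subvP => u.
rewrite memv_cap memv_ker lfunE memv0 => /andP[_ /eqP/ffunP u0].
apply/eqP/ffunP => i; have := u0 i; rewrite !ffunE => /eqP.
by rewrite fmorph_eq0 => /eqP.
Qed.

Lemma vec_of_extend_field U v :
  vec_of U v -> vec_of (extend_field iota U) (map_mx iota v).
Proof.
case=> u Uu ->; exists (ffun_embed iota u); last by rewrite torow_embed.
by apply/mem_extend_fieldP; exists u.
Qed.

Lemma linear_set_extend_field U v : vec_of U v -> v != 0 ->
  linear_set (extend_field iota U) <[map_mx iota v]>%VS.
Proof.
move=> Uv nz_v; have [w Uw vw] := vec_of_extend_field Uv.
exists w; split; rewrite -?vw //; apply: contraNneq nz_v => w0.
rewrite -(map_mx_eq0 iota) vw w0; apply/eqP/rowP => i.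
by rewrite !mxE ffunE.
Qed.

(** Rationality over [L] is what the lower bound on the number of points rests on. *)
Lemma linear_set_extend_field_rational U P :
  linear_set (extend_field iota U) P ->
  exists v : 'rV[L]_k, P = <[map_mx iota v]>%VS.
Proof.
case=> _ [/mem_extend_fieldP[u _ ->] _ ->].
by exists (torow u); rewrite torow_embed.
Qed.

(** [U] contains an [L]-basis of [L^k]; its matrix is invertible over [L], hence over [E], so these
    vectors also span [E^k]. *)
Lemma is_system_extend_field U n :
  is_system n U -> is_system n (extend_field iota U).
Proof.
case=> dimU spanU; split; first by rewrite dim_extend_field.
split=> [v _|W' sUW']; first exact: memvf.
have dimf : \dim {:'rV[L]_k} = k by rewrite dimvf /dim /= mul1n.
have [M [frM UM _]] := is_span_row_free spanU dimf.
have uM : map_mx iota M \in unitmx by rewrite map_unitmx -row_free_unit.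
apply/subvP => v _; rewrite -(mulmxKV uM v).
by apply: mulmx_memv => i; rewrite -map_row; apply/sUW'/vec_of_extend_field.
Qed.

Lemma points_covered_extend_field U d :
  k = d.+2 -> \dim {:E} = (\dim {:L} * d.+1)%N ->
  linear_cutting_blocking_set U ->
  points_covered d (linear_set (extend_field iota U)).
Proof.
move=> kd dimE cutU P dimP.
have [b [bgen _]] := fieldExt_row_basis dimE.
have [C vC] := bgen _ (vpick P).
(* [C] has only [d.+1 = k - 1] rows, so their span fits in a hyperplane [H], even if they are
   dependent. *)
have [|H sCH dimH] := @exists_superspace _ _ <<codom (fun i => row i C)>>%VS d.+1.
  rewrite (leq_trans (dim_span _)) ?size_codom ?card_ord //.
  by rewrite dimvf /dim /= mul1n kd.
have dimH' : \dim H = k.-1 by rewrite dimH kd.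
have [M [frM UM HM]] := is_span_row_free (cutU _ dimH') dimH.
have /submxP[D CD] : (C <= M)%MS.
  apply/row_subP => i; apply: HM; apply: (subvP sCH).
  exact/memv_span/(codom_f (fun i => row i C)).
have frM' : row_free (map_mx iota M) by rewrite row_free_map.
exists [tuple <[row i (map_mx iota M)]>%VS | i < d.+1]; split.
- by rewrite map_inj_uniq ?enum_uniq //; apply: row_free_line_inj.
- move=> Q /mapP[i _ ->]; rewrite -map_row.
  apply: linear_set_extend_field; first by case: (UM i).
  (* A zero row of [M] would identify a unit vector with [0]. *)
  apply/eqP => Mi0; have := row_free_inj frM (m := 1) (x1 := delta_mx 0 i) (x2 := 0).
  rewrite -rowE Mi0 mul0mx => /(_ erefl) /rowP /(_ i) /eqP.
  by rewrite !mxE !eqxx oner_eq0.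
have -> : P = <[vpick P]>%VS.
  apply/esym/eqP; rewrite eqEdim -memvE memv_pick dimP dim_vline vpick0.
  by rewrite -dimv_eq0 dimP.
(* With [C = D *m M], the vector is [(b *m D) *m M] over [E], a combination of the rows of [M]. *)
rewrite -memvE vC CD map_mxM mulmxA; apply: mulmx_memv => i.
rewrite big_map big_enum; apply: subvP (memv_line _).
exact: (sumv_sup i).
Qed.

(* The equations [cokermx N] of a span of [L]-rational points are themselves
   over [L], so by freeness of [b] they kill every row of [C]. *)
Lemma points_covered_extend_field_min U d r :
  (0 < d <= k)%N -> \dim {:E} = (\dim {:L} * d)%N ->
  points_covered r (linear_set (extend_field iota U)) -> (d <= r.+1)%N.
Proof.
move=> /andP[d_gt0 ledk] dimE cov.
have [b [_ bfree]] := fieldExt_row_basis dimE.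
pose C : 'M[L]_(d, k) := pid_mx d.
have rC : \rank C = d by rewrite rank_pid_mx.
pose v := b *m map_mx iota C.
have nz_v : v != 0.
  apply: contraTneq d_gt0 => /bfree C0.
  by rewrite -rC C0 mxrank0.
have [|s [_ Ss]] := cov <[v]>%VS; first by rewrite dim_vline nz_v.
have repP i : exists w : 'rV[L]_k, tnth s i == <[map_mx iota w]>%VS.
  by have [w ->] := linear_set_extend_field_rational (Ss _ (mem_tnth i s)); exists w.
pose N : 'M[L]_(r.+1, k) := \matrix_i xchoose (repP i).
rewrite -memvE big_tuple => /memv_sumP[y sy vy].
(* [N] has one row per point of [s], so its rank is at most [r.+1], while [C] has rank [d]. *)
suff: (C <= N)%MS by move/mxrankS; rewrite rC => /leq_trans; apply; apply: rank_leq_row.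
rewrite submxE; apply/eqP/bfree; rewrite map_mxM mulmxA -/v vy mulmx_suml.
apply: big1 => i _; have := sy i isT; rewrite (eqP (xchooseP (repP i))).
case/vlineP=> c ->; rewrite -scalemxAl -map_mxM.
have -> : xchoose (repP i) = row i N by rewrite rowK.
by rewrite -row_mul mulmx_coker row0 map_mx0 scaler0.
Qed.

End Extension.

Theorem theorem4p6 (q m n k : nat) (F : finFieldType) (L E : fieldExtType F)
  (iota : {lrmorphism L -> E}) (U : {vspace {ffun 'I_k -> L}})
  (hq : #|F| = q) (hm : (0 < m)%N) (hn : (0 < n)%N) (hk : (2 <= k)%N)
  (hL : \dim {:L} = m) (hE : \dim {:E} = (m * (k - 1))%N)
  (hU : is_system n U) (hcut : linear_cutting_blocking_set U) :
  is_system n (extend_field iota U) /\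
  rank_saturating (k - 1) (extend_field iota U).
Proof.
split; first exact: is_system_extend_field.
(* Rank [k - 1] means saturation index [k - 2], that is, spans of [k - 1] points; [hk] makes the
   subtraction exact. *)
have k1E : (k - 1 = (k - 2).+1)%N by rewrite -subSn.
rewrite -hL k1E in hE; rewrite k1E; split=> //; split.
  apply: points_covered_extend_field => //.
  by rewrite -k1E subn1 prednK // ltnW.
move=> r cov; rewrite /= -ltnS.
apply: points_covered_extend_field_min hE cov.
by rewrite /= -k1E leq_subr.
Qed.
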